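(* Let $X_x$ be a regular Toeplitz system and let $P\in\mathbb{Z}[X]$. If the orbit $(\sigma^{P(n)}y)_{n\ge1}$ is dense in $X_x$ for some $y\in X_x$, then for all $y\in X_x$ the orbit $(\sigma^{P(n)}y)_{n\ge 1}$ is equidistributed in $X_x$ with respect to the unique $\sigma$-invariant probability measure on $X_x$.
   Context: Let $\sigma$ be the left shift on $\{0,1\}^{\mathbb{Z}}$ (product topology), $(\sigma y)(i)=y(i+1)$. A word $x\in\{0,1\}^{\mathbb{Z}}$ is called a Toeplitz word if for every $a\in\mathbb{Z}$ there exists $\ell\in\mathbb{Z}^+$ such that $x(a)=x(a+j\ell)$ for all $j\in\mathbb{Z}$. The Toeplitz system $X_x$ is the orbit closure $\overline{\{\sigma^n x:n\in\mathbb{Z}\}}$ in $\{0,1\}^{\mathbb{Z}}$ with the action of $\sigma$; it is minimal. For $n\in\mathbb{Z}^+$ let $\mathrm{Per}_n(x)=\{a\in\mathbb{Z}: x(a)=x(a+jn)\text{ for all }j\in\mathbb{Z}\}$. Every Toeplitz word $x$ admits a sequence $(n_t)_{t\ge 0}$ of positive integers with $n_t\mid n_{t+1}$ and $\bigcup_{t\ge0}\mathrm{Per}_{n_t}(x)=\mathbb{Z}$. The system $X_x$ is called regular if, for such a sequence, the density of $\bigcup_{t=0}^M\mathrm{Per}_{n_t}(x)$ in $\mathbb{Z}$ converges to $1$ as $M\to\infty$. A regular Toeplitz system is strictly ergodic (minimal with a unique $\sigma$-invariant Borel probability measure). For the unique $\sigma$-invariant probability measure $\mu$ on $X_x$, an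 orbit $(\sigma^{a_n}y)_{n\ge1}$ is equidistributed with respect to $\mu$ if $\frac1N\sum_{n\le N}F(\sigma^{a_n}y)\to\int_{X_x}F\,d\mu$ as $N\to\infty$ for every continuous $F:X_x\to\mathbb{C}$. *)

(* Defs.v *)
From HB Require Import structures.
From mathcomp Require Import all_boot all_order all_algebra.
From mathcomp Require Import all_classical all_reals all_analysis.
From mathcomp Require Import complex.

Set Implicit Arguments.
Unset Strict Implicit.
Unset Printing Implicit Defensive.

Import Order.TTheory GRing.Theory Num.Theory.
Import numFieldNormedType.Exports.

Local Open Scope classical_set_scope.
Local Open Scope ring_scope.

Notation word := {ptws int -> bool}.

(* [shiftw n] is the n-th power (n : int) of the left shift [shiftw 1]; see
   [shiftw0] and [shiftwD]. *)
Definition shiftw (n : int) (y : word) : word := fun i => y (i + n).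

Lemma shiftw0 (y : word) : shiftw 0 y = y.
Proof. by apply/funext => i; rewrite /shiftw addr0. Qed.

Lemma shiftwD (m n : int) (y : word) :
  shiftw (m + n) y = shiftw m (shiftw n y).
Proof. by apply/funext => i; rewrite /shiftw addrA. Qed.

Lemma shiftw_continuous (n : int) : continuous (shiftw n).
Proof.
move=> y; apply/cvg_sup => i A [_ [[V oV <-] Vyi VA]].
have := @proj_continuous _ (fun=> bool) (i + n) y V (open_nbhs_nbhs (conj oV Vyi)).
exact: (@filterS _ (nbhs y) _ _ _ (fun z => VA (shiftw n z))).
Qed.

Definition toeplitz_word (x : word) : Prop :=
  forall a : int, exists2 l : nat, (0 < l)%N &
    forall j : int, x a = x (a + j * l%:Z).

Definition Per (n : nat) (x : word) : set int :=
  [set a | forall j : int, x a = x (a + j * n%:Z)].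

(* Density along the windows [-N, N]. *)
Definition has_density (R : realType) (A : set int) (d : R) : Prop :=
  (\sum_(i < N.*2.+1) \1_A (i%:Z - N%:Z)) / N.*2.+1%:R @[N --> \oo] --> d.

(* For a Toeplitz word the limit does not depend on the choice of [n_] with
   the first three properties, so "some" and "every" such sequence agree. *)
Definition regular_system (R : realType) (x : word) : Prop :=
  exists n_ : nat -> nat,
    [/\ forall t, (0 < n_ t)%N,
        forall t, (n_ t %| n_ t.+1)%N,
        \bigcup_t Per (n_ t) x = [set: int] &
        exists2 d : nat -> R,
          forall M, has_density (\bigcup_(t < M.+1) Per (n_ t) x) (d M) &
          d @ \oo --> (1 : R)].

Definition orbit_closure (x : word) : set word :=
  closure [set shiftw n x | n in [set: int]].

Lemma orbit_closure_self (x : word) : orbit_closure x x.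
Proof. by apply: subset_closure; exists 0 => //; exact: shiftw0. Qed.

Lemma orbit_closure_shiftw (x : word) (n : int) (y : word) :
  orbit_closure x y -> orbit_closure x (shiftw n y).
Proof.
move=> xy B /shiftw_continuous /xy [_ [[m _ <-] Bm]].
by exists (shiftw (n + m) x); split; [exists (n + m) | rewrite shiftwD].
Qed.

(* The orbit closure as a type, with the subspace topology. *)
Definition toeplitz_system (x : word) : Type := set_type (orbit_closure x).

HB.instance Definition _ (x : word) := Topological.on (toeplitz_system x).
HB.instance Definition _ (x : word) := isPointed.Build (toeplitz_system x)
  (exist _ x (mem_set (@orbit_closure_self x))).

Definition system_shift (x : word) (n : int) (y : toeplitz_system x) :
    toeplitz_system x :=
  exist _ (shiftw n (set_val y))
    (mem_set (orbit_closure_shiftw (n := n) (set_valP y))).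

Notation borel T := (g_sigma_algebraType (@open T)).

Definition shift_invariant (R : realType) (x : word)
    (mu : probability (borel (toeplitz_system x)) R) : Prop :=
  forall A : set (borel (toeplitz_system x)), measurable A ->
    mu (@system_shift x 1 @^-1` A) = mu A.

Definition Cintegral (R : realType) (x : word)
    (mu : probability (borel (toeplitz_system x)) R)
    (F : toeplitz_system x -> R[i]) : R[i] :=
  Complex (\int[mu]_y complex.Re (F y)) (\int[mu]_y complex.Im (F y)).

(* Only the terms u 1, u 2, ... matter.  [R[i]^o] carries the topology given
   by the modulus. *)
Definition equidistributed (R : realType) (x : word)
    (mu : probability (borel (toeplitz_system x)) R)
    (u : nat -> toeplitz_system x) : Prop :=
  forall F : toeplitz_system x -> R[i]^o, continuous F ->
    (\sum_(1 <= n < N.+1) F (u n)) / N%:R @[N --> \oo] -->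
      (Cintegral mu F : R[i]^o).

(* Main.v *)
Require Import Defs.
From mathcomp Require Import all_boot all_order all_algebra.
From mathcomp Require Import all_classical all_reals all_analysis.
From mathcomp Require Import complex.
From mathcomp Require Import measurable_realfun.
From mathcomp Require Import zify ring lra.

(* For a suitable period m, the m-periodic part of x determines at which residue
   mod m each point of the system sits.  A dense polynomial orbit visits all
   these residues, so P is surjective, hence bijective, mod m, and P(n) is exactly
   equidistributed mod m.  By regularity m can be chosen so that a given window
   of sigma^(P(n)) y is determined by the residue of P(n) for all n outside a
   set of small density.  For a continuous F, both the averages of
   F(sigma^(P(n)) y) and those of F(sigma^n z) are therefore uniformly close to
   the average of F over sigma^0 x, ..., sigma^(m-1) x; integrating the latter
   with respect to mu identifies the limit. *)

Set Implicit Arguments.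
Unset Strict Implicit.
Unset Printing Implicit Defensive.

Import Order.TTheory GRing.Theory Num.Theory.
Import numFieldNormedType.Exports.

Local Open Scope classical_set_scope.
Local Open Scope ring_scope.

(** * Essential periods and residues of points of the system *)

Lemma Per_eqmod (x : word) (m : nat) (a b : int) :
  (m%:Z %| b - a)%Z -> Per m x a -> Per m x b /\ x b = x a.
Proof.
move=> /dvdzP[q qE] xa; have -> : b = a + q * m%:Z by rewrite -qE; ring.
by split=> [j|]; rewrite -?addrA -?mulrDl -!xa.
Qed.

(* Without this minimality the residue of a point need not be unique: a constant
   word has every positive integer as a period. *)
Definition essential_period (x : word) (m : nat) : Prop :=
  (0 < m)%N /\
  forall k : nat, (0 < k)%N -> Per m x `<=` Per k x -> (m <= k)%N.

(** The least positive k with [Per n x] inside [Per k x] works: any competitor for its minimality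
    also contains [Per n x]. *)
Lemma essential_periodW (x : word) (n : nat) : (0 < n)%N ->
  exists2 m, essential_period x m & Per n x `<=` Per m x.
Proof.
move=> n0; pose Q k := (0 < k)%N && `[< Per n x `<=` Per k x >].
have exQ : exists k, Q k by exists n; rewrite /Q n0; apply/asboolP.
case: (ex_minnP exQ) => m /andP[m0 /asboolP nm] m_min.
exists m => //; split=> // k k0 mk; apply: m_min.
by rewrite /Q k0; apply/asboolP; exact: subset_trans mk.
Qed.

(** If d had a nonzero remainder k modulo m, every m-periodic position would also be k-periodic, and
    minimality would give m <= k < m. *)
Lemma essential_period_dvd (x : word) (m : nat) (d : int) :
  essential_period x m ->
  (forall i, Per m x i -> Per m x (i + d) /\ x (i + d) = x i) ->
  (m%:Z %| d)%Z.
Proof.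
move=> [m0 m_min] xd.
have iter_d (j : nat) i : Per m x i ->
    Per m x (i + j%:Z * d) /\ x (i + j%:Z * d) = x i.
  move=> xi; elim: j => [|j [xj xjE]]; first by rewrite mul0r addr0.
  have -> : i + j.+1%:Z * d = i + j%:Z * d + d by rewrite intS; ring.
  by have [? ->] := xd _ xj.
have mN0 : m%:Z != 0 by rewrite eqz_nat -lt0n.
have [k kE] : exists k : nat, (d %% m%:Z)%Z = k%:Z.
  by exists `|(d %% m%:Z)%Z|%N; rewrite gez0_abs // modz_ge0.
have km : (k < m)%N by rewrite -ltz_nat -kE ltz_pmod.
have dE := divz_eq d m; rewrite kE in dE.
case: (posnP k) => [k0|k0]; first by apply/dvdz_mod0P; rewrite kE k0.
have: (m <= k)%N; last by rewrite leqNgt km.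
apply: m_min => // i xi j.
(* [iter_d] only handles nonnegative multiples of d, and j may be negative. *)
have [J JE] : exists J : nat, J%:Z = j + `|j| * m%:Z.
  by exists (absz (j + `|j| * m%:Z)); rewrite gez0_abs //; nia.
have [xj <-] := iter_d J i xi.
(* J = j and d = k modulo m, so i + j k and i + J d are congruent modulo m. *)
have [|_ ->//] := @Per_eqmod x m (i + J%:Z * d) (i + j * k%:Z) _ xj.
rewrite JE dE; apply/dvdzP.
by exists (- (j * (d %/ m%:Z)%Z + `|j| * (d %/ m%:Z)%Z * m%:Z + `|j| * k%:Z)); ring.
Qed.

(* Within the system and for an essential period m, this is the fibre over r of
   the factor map onto Z/m. *)
Definition aligned (x : word) (m : nat) (r : int) : set word :=
  [set z | forall i, Per m x (i + r) -> z i = x (i + r)].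

Lemma aligned_eqmod (x z : word) (m : nat) (r s : int) :
  (m%:Z %| s - r)%Z -> aligned x m r z -> aligned x m s z.
Proof.
move=> rs xz i xi.
have [|xi' <-] := @Per_eqmod x m (i + s) (i + r) _ xi; last exact: xz.
by have -> : i + r - (i + s) = - (s - r) by [ring]; rewrite rpredN.
Qed.

Lemma aligned_shiftw (x z : word) (m : nat) (r n : int) :
  aligned x m r z -> aligned x m (n + r) (shiftw n z).
Proof. by move=> xz i; rewrite addrA; exact: xz. Qed.

Lemma aligned_self (x : word) (m : nat) : aligned x m 0 x.
Proof. by move=> i _; rewrite addr0. Qed.

(** Alignment makes translation by c - r preserve the m-periodic positions and their values. A point
    of the orbit thus has only one residue. *)
Lemma aligned_orbit_eqmod (x : word) (m : nat) (r c : int) :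
  essential_period x m -> aligned x m r (shiftw c x) -> (m%:Z %| c - r)%Z.
Proof.
move=> m_ess xc; apply: (essential_period_dvd m_ess) => i xi.
have eq_i (j : int) : x (i + (c - r) + j * m%:Z) = x i.
  have [|xj <-] := @Per_eqmod x m i (i + j * m%:Z) _ xi.
    by rewrite addrC addKr dvdz_mull.
  have -> : i + (c - r) + j * m%:Z = i + j * m%:Z - r + c by ring.
  by rewrite [LHS](xc (i + j * m%:Z - r)) subrK.
by split=> [j|]; rewrite -[x (i + _)](congr1 x (addr0 _)) -[0](mul0r m%:Z) ?eq_i.
Qed.

Lemma closed_aligned (x : word) (m : nat) (r : int) : closed (aligned x m r).
Proof.
have -> : aligned x m r = \bigcap_(i in [set i | Per m x (i + r)])
    (fun z : word => z i) @^-1` [set x (i + r)].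
  by apply/seteqP; split=> z xz i; exact: xz.
apply: closed_bigI => i _; apply: closed_comp => [z _|]; first exact: proj_continuous.
exact: discrete_closed.
Qed.

Lemma dvdz_residue (m : nat) (c : int) : (0 < m)%N ->
  exists2 k : nat, (k < m)%N & (m%:Z %| k%:Z - c)%Z.
Proof.
move=> m0; exists `|(c %% m%:Z)%Z|%N; have mN0 : m%:Z != 0 by rewrite eqz_nat -lt0n.
  by rewrite -ltz_nat gez0_abs ?modz_ge0 // ltz_pmod.
rewrite gez0_abs ?modz_ge0 // {2}(divz_eq c m).
by rewrite opprD addrCA subrr addr0 rpredN dvdz_mull.
Qed.

(** Finitely many closed sets [aligned x m k] cover the orbit, hence also its closure. *)
Lemma orbit_closure_aligned (x z : word) (m : nat) :
  (0 < m)%N -> orbit_closure x z -> exists r, aligned x m r z.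
Proof.
move=> m0 xz; have : (\bigcup_(k < m) aligned x m k%:Z) z.
  have : closed (\bigcup_(k < m) aligned x m k%:Z).
    by apply: closed_bigcup => [|k _]; [exact: finite_II|exact: closed_aligned].
  apply; move: z xz; apply: closure_subset => _ [c _ <-].
  have [k km kc] := dvdz_residue c m0; exists k => //.
  by apply: aligned_eqmod kc _; rewrite -[X in aligned _ _ X]addr0;
    exact/aligned_shiftw/aligned_self.
by move=> [k _ xk]; exists k%:Z.
Qed.

(** If y has residue r, its shift by p n has residue p n + r. The points aligned with no residue
    other than c + r form an open set containing [shiftw (c + r) x], so the dense orbit enters
    it. *)
Lemma dense_orbit_residues (x : word) (p : nat -> int) (D : set nat)
    (y : toeplitz_system x) (m : nat) :
  dense [set system_shift (p n) y | n in D] -> essential_period x m ->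
  forall c : int, exists n, (m%:Z %| p n - c)%Z.
Proof.
move=> p_dense m_ess c; have [m0 _] := m_ess.
have [r xy] := orbit_closure_aligned m0 (set_valP y).
pose bad := \bigcup_(k in [set k : nat | (k < m)%N /\ ~~ (m%:Z %| c + r - k%:Z)%Z])
  aligned x m k%:Z.
have clbad : closed bad.
  apply: closed_bigcup => [|k _]; last exact: closed_aligned.
  by apply: sub_finite_set (finite_II m) => k [].
pose U : set (toeplitz_system x) := set_val @^-1` ~` bad.
have oU : open U.
  by apply: open_comp => [z _|]; [exact: initial_continuous|exact: closed_openC].
have U0 : U !=set0.
  exists (system_shift (c + r) point) => -[k [_ /negP kc] xk].
  by apply: kc; exact: aligned_orbit_eqmod xk.
have [z [Uz [n _ zE]]] := p_dense U U0 oU; subst z; exists n.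
have [k km kn] := dvdz_residue (p n + r) m0.
have xk : aligned x m k%:Z (shiftw (p n) (set_val y)).
  by apply: aligned_eqmod kn _; exact: aligned_shiftw.
have -> : p n - c = - ((c + r - k%:Z) + (k%:Z - (p n + r))) by ring.
rewrite rpredN rpredD //; apply/negPn/negP => kc.
by apply: Uz; exists k.
Qed.

(** * Residues of polynomial values and periodic sums *)

Lemma horner_eqmod (P : {poly int}) (d a b : int) :
  (d %| a - b)%Z -> (d %| P.[a] - P.[b])%Z.
Proof.
move=> dab; elim/poly_ind: P => [|P c IH]; first by rewrite !horner0 subrr dvdz0.
rewrite !hornerMXaddC.
have -> : P.[a] * a + c - (P.[b] * b + c) = P.[a] * (a - b) + b * (P.[a] - P.[b]).
  by ring.
by rewrite rpredD // dvdz_mull.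
Qed.

(** For m > 0 such a phi induces a surjective, hence bijective, self-map of Z/m. The notion covers
    at once the values of P, the identity and their translates. *)
Definition residue_cover (m : nat) (phi : nat -> int) : Prop :=
  (forall k l : nat, (m%:Z %| k%:Z - l%:Z)%Z -> (m%:Z %| phi k - phi l)%Z) /\
  (forall c : int, exists n, (m%:Z %| phi n - c)%Z).

Lemma residue_cover_addr (m : nat) (phi : nat -> int) (r : int) :
  residue_cover m phi -> residue_cover m (fun n => phi n + r).
Proof.
move=> [cong surj]; split=> [k l /cong|c]; first by rewrite opprD addrACA subrr addr0.
have [n nc] := surj (c - r); exists n.
by have -> : phi n + r - c = phi n - (c - r) by ring.
Qed.

Lemma residue_cover_Posz (m : nat) : (0 < m)%N -> residue_cover m Posz.
Proof. by move=> m0; split=> // c; have [k _] := dvdz_residue c m0; exists k. Qed.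

(** Needed because orbits are indexed from n = 1 while the sums below start at 0. *)
Lemma residue_coverS (m : nat) (phi : nat -> int) : (0 < m)%N ->
  residue_cover m phi -> residue_cover m (fun n => phi n.+1).
Proof.
move=> m0 [cong surj]; split=> [k l kl|c].
  by apply: cong; have -> : k.+1%:Z - l.+1%:Z = k%:Z - l%:Z by lia.
(* The successor of this witness is n + m, congruent to n. *)
have [n nc] := surj c; exists (n + m.-1)%N.
rewrite -(subrK (phi n) (phi _)) -addrA rpredD // cong //.
by rewrite -addnS prednK // PoszD addrC addKr dvdzz.
Qed.

Lemma eq_residue (m k l : nat) : (k < m)%N -> (l < m)%N ->
  (m%:Z %| k%:Z - l%:Z)%Z -> k = l.
Proof. by move=> km lm; rewrite -eqz_mod_dvd !modz_nat !modn_small // => /eqP[]. Qed.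

(** On residues phi acts as a permutation g of ['I_m]: it is surjective on a finite set. The sum is
    reindexed by g. *)
Lemma sum_residue_cover (V : nmodType) (m : nat) (phi : nat -> int) (h : int -> V) :
  (0 < m)%N -> residue_cover m phi ->
  (forall a b, (m%:Z %| a - b)%Z -> h a = h b) ->
  \sum_(k < m) h (phi k) = \sum_(k < m) h k%:Z.
Proof.
move=> m0 [cong surj] h_per.
have /choice[g gE] : forall k : 'I_m, exists l : 'I_m, (m%:Z %| l%:Z - phi k)%Z.
  by move=> k; have [l lm lE] := dvdz_residue (phi k) m0; exists (Ordinal lm).
have /choice[s sE] : forall l : 'I_m, exists k : 'I_m, g k = l.
  move=> l; have [n nl] := surj l%:Z; have [k km kn] := dvdz_residue n%:Z m0.
  exists (Ordinal km); apply/val_inj; apply: eq_residue (ltn_ord _) (ltn_ord _) _.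
  have := rpredD (rpredD (gE (Ordinal km)) (cong _ _ kn)) nl.
  by rewrite /= !subrKA.
have [t gt tg] : bijective g by exists s => //; apply/(bij_can_sym (injF_bij (can_inj sE))).
rewrite [RHS](reindex g) /=; last by exists t => ? _; [exact: gt|exact: tg].
by apply: eq_bigr => k _; apply: h_per; rewrite -opprB rpredN.
Qed.

(** Each full period contributes exactly its share and is removed by induction. For N < m both terms
    are at most m B. *)
Lemma periodic_sum_bound (R : realFieldType) (m : nat) (u : nat -> R) (B : R) (N : nat) :
  (0 < m)%N -> (forall n, u (n + m)%N = u n) -> (forall n, `|u n| <= B) ->
  `|\sum_(n < N) u n - N%:R / m%:R * \sum_(n < m) u n| <= 2 * m%:R * B.
Proof.
move=> m0 u_per uB; have mR : 0 < m%:R :> R by rewrite ltr0n.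
have sB k : `|\sum_(n < k) u n| <= k%:R * B.
  by apply: le_trans (ler_norm_sum _ _ _) _; rewrite mulr_natl -[X in _ *+ X]card_ord
    -sumr_const ler_sum.
have B0 : 0 <= B by exact: le_trans (uB 0%N).
elim/ltn_ind: N => N IH; have [Nm|mN] := ltnP N m.
  apply: le_trans (ler_normB _ _) _; rewrite mulrDl mul1r mulrDl lerD //.
    by apply: le_trans (sB N) _; rewrite ler_wpM2r // ler_nat ltnW.
  rewrite normrM ger0_norm ?divr_ge0 //.
  apply: le_trans (ler_wpM2l _ (sB m)) _; first by rewrite divr_ge0.
  by rewrite mulrA divfK ?gt_eqF // ler_wpM2r // ler_nat ltnW.
rewrite -(subnKC mN) big_split_ord /=.
under [X in _ + X - _]eq_bigr do rewrite addnC u_per.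
rewrite natrD mulrDl divff ?gt_eqF // mulrDl mul1r opprD addrACA subrr add0r.
by apply: IH; rewrite ltn_subrL m0 (leq_trans m0).
Qed.

Lemma residue_cover_sum_bound (R : realFieldType) (m : nat) (phi : nat -> int)
    (h : int -> R) (B : R) (N : nat) :
  (0 < m)%N -> residue_cover m phi ->
  (forall a b, (m%:Z %| a - b)%Z -> h a = h b) -> (forall a, `|h a| <= B) ->
  `|\sum_(n < N) h (phi n) - N%:R / m%:R * \sum_(k < m) h k%:Z| <= 2 * m%:R * B.
Proof.
move=> m0 phi_cov h_per hB; rewrite -(sum_residue_cover m0 phi_cov h_per).
apply: (@periodic_sum_bound R m (fun n => h (phi n))) => // n.
by apply/h_per/phi_cov.1; rewrite PoszD addrC addKr dvdzz.
Qed.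

(** * Compactness of the system and continuous functions on it *)

Lemma compact_set_type (T : topologicalType) (A : set T) :
  compact A -> compact [set: set_type A].
Proof.
move=> /compact_near_coveringP/near_covering_withinP cA.
apply/compact_near_coveringP => I F Q FF QF.
have : \near F, A `<=` (fun w => forall z : set_type A, set_val z = w -> Q F z).
  apply: cA => w Aw; have [[U V] /= [zU FV] UV] := QF (exist _ w (mem_set Aw)) Logic.I.
  case: zU => _ [[W oW <-] /= Wz WU].
  exists (W, V); first by split=> //; exact: open_nbhs_nbhs.
  move=> [w' i] [/= Ww' Vi] _ z zw'; apply: (UV (z, i)); split=> //=.
  by apply: WU; rewrite /preimage /= zw'.
by apply: filterS => i Qi z _; exact: Qi (set_valP z) z erefl.
Qed.

Lemma word_compact : compact [set: word].
Proof.
have := @tychonoff _ (fun _ : int => bool) _ (fun=> bool_compact).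
by congr (compact _); rewrite eqEsubset.
Qed.

Lemma toeplitz_system_compact (x : word) : compact [set: toeplitz_system x].
Proof.
apply: compact_set_type; apply: subclosed_compact word_compact _ => //.
exact: closed_closure.
Qed.

(** These windows give a base of neighbourhoods of y in the product topology and stand in for a
    metric. *)
Definition agree_on (L : nat) (y z : word) : Prop :=
  forall i : int, `|i| <= L%:Z -> z i = y i.

(** Convergence in the product is tested on single coordinates, and coordinate i is fixed by the
    window of radius |i|. *)
Lemma nbhs_word (y : word) (A : set word) :
  nbhs y A -> exists L, agree_on L y `<=` A.
Proof.
pose G : set_system word := filter_from [set: nat] (fun L => agree_on L y).
have GF : Filter G.
  apply: filter_from_filter; first by exists 0%N.
  move=> K L _ _; exists (maxn K L) => // z yz; split=> i iL; apply: yz;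
    apply: le_trans iL _; rewrite lez_nat ?leq_maxl ?leq_maxr //.
suff Gy : G --> y by move=> /Gy [L _ LA]; exists L.
apply/cvg_sup => i B [_ [[V oV <-] Vyi VB]].
by exists `|i|%N => // z yz; apply: VB; rewrite /preimage /= yz // abszE.
Qed.

Lemma nbhs_agree_on (L : nat) (y : word) : nbhs y (agree_on L y).
Proof.
have : \forall z \near y, forall k : 'I_L.*2.+1, z (k%:Z - L%:Z) = y (k%:Z - L%:Z).
  apply: (filter_forall (nbhs_filter y)) => k.
  apply: (@proj_continuous _ (fun=> bool) (k%:Z - L%:Z) y [set y (k%:Z - L%:Z)]).
  by apply: open_nbhs_nbhs; split=> //; exact: discrete_open.
apply: filterS => z yz i iL.
have iL' : (absz (i + L%:Z)%R < L.*2.+1)%N by lia.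
have := yz (Ordinal iL'); rewrite /=.
by have -> : (absz (i + L%:Z))%:Z - L%:Z = i by lia.
Qed.

(** Uniform continuity in terms of windows: compactness, used as a near covering along L tending to
    infinity, makes the local radii uniform. *)
Lemma continuous_agree (R : realType) (x : word) (F : toeplitz_system x -> R)
    (e : R) : continuous F -> 0 < e ->
  exists L, forall y z : toeplitz_system x,
    agree_on L (set_val y) (set_val z) -> `|F y - F z| <= e.
Proof.
move=> cF e0.
have /compact_near_coveringP/(_ nat \oo
  (fun L y => forall z : toeplitz_system x,
    agree_on L (set_val y) (set_val z) -> `|F y - F z| <= e)) := @toeplitz_system_compact x.
case=> [y _|L _ LF]; last by exists L => y; apply: (LF L _ y) => /=.
have /cvgr_dist_le/(_ _ (divr_gt0 e0 (ltr0Sn _ 1)))[_ [[V oV <-] /= Vy VF]] := cF y.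
have [L LV] := nbhs_word (open_nbhs_nbhs (conj oV Vy)).
exists ([set z : toeplitz_system x | agree_on L (set_val y) (set_val z)],
  [set K | (L <= K)%N]) => /=.
  split; last by exists L.
  by apply: (@initial_continuous _ _ set_val); exact: nbhs_agree_on.
(* Here z agrees with y on [-L, L] and w agrees with z on [-K, K], where K >= L; so F z and F w are
   both within e/2 of F y. *)
move=> [z K] [/= yz LK] w zw; rewrite (splitr e).
have -> : F z - F w = (F y - F w) - (F y - F z) by ring.
apply: le_trans (ler_normB _ _) (lerD _ _); apply: VF; apply: LV => //.
by move=> i iL; rewrite zw ?yz // (le_trans iL) // lez_nat.
Qed.

Lemma continuous_bounded (R : realType) (x : word) (F : toeplitz_system x -> R) :
  continuous F -> exists2 M : R, 0 <= M & forall y, `|F y| <= M.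
Proof.
move=> cF.
have /compact_bounded[M [_ MF]] : compact (range F).
  apply: continuous_compact; last exact: toeplitz_system_compact.
  exact: continuous_subspaceT.
exists (`|M| + 1) => [|y]; first by rewrite addr_ge0.
by apply: (MF (`|M| + 1)); [rewrite ltr_pwDr // ler_norm|exists y].
Qed.

(** * Density of periodic positions and uniform averages *)

Lemma indic_Per_eqmod (R : numDomainType) (x : word) (m : nat) (a b : int) :
  (m%:Z %| a - b)%Z -> \1_(Per m x) a = \1_(Per m x) b :> R.
Proof.
move=> ab; rewrite !indicE; congr (nat_of_bool _)%:R.
apply/idP/idP; rewrite !inE => /Per_eqmod xP; [have [] := xP b|have [] := xP a] => //.
by rewrite -opprB rpredN.
Qed.

Lemma indic_norm_le1 (R : numDomainType) (T : Type) (A : set T) (a : T) :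
  `|\1_A a : R| <= 1.
Proof. by rewrite indicE; case: (_ \in _); rewrite ?normr1 ?normr0. Qed.

(** In each window A has at most as many points as [Per m x], whose count differs from its exact
    proportion by at most 2m; this error vanishes after division by the window length. *)
Lemma density_Per_le (R : realType) (x : word) (m : nat) (A : set int) (d : R) :
  (0 < m)%N -> A `<=` Per m x -> has_density A d ->
  d <= (\sum_(k < m) \1_(Per m x) k%:Z) / m%:R.
Proof.
move=> m0 Am Ad; set S := \sum_(k < m) _; apply/ler_addgt0Pr => e e0.
have [N] : exists N : nat, d - e / 2 <= (\sum_(i < N.*2.+1) \1_A (i%:Z - N%:Z)) / N.*2.+1%:R /\
    2 * m%:R / N.*2.+1%:R <= e / 2.
  have e2 : 0 < e / 2 by rewrite divr_gt0.
  have /cvgr_dist_le/(_ _ e2) dN := Ad.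
  near \oo => N; exists N; split.
    have : `|d - (\sum_(i < N.*2.+1) \1_A (i%:Z - N%:Z)) / N.*2.+1%:R| <= e / 2.
      by near: N.
    by rewrite ler_norml => /andP[_]; rewrite lerBlDr -lerBlDl.
  rewrite ler_pdivrMr ?ltr0n // -ler_pdivrMl // (@le_trans _ _ N%:R) //.
    by near: N; exact: nbhs_infty_ger.
  by rewrite ler_nat -addnn; lia.
have N0 : 0 < N.*2.+1%:R :> R by rewrite ltr0n.
move=> [dN mN]; rewrite -lerBlDr (@le_trans _ _ (d - e / 2 - e / 2)) //; first lra.
rewrite lerBlDr; apply: le_trans dN _.
apply: le_trans (lerD (lexx _) mN).
rewrite ler_pdivrMr // mulrDl divfK ?gt_eqF //.
(* The map k -> k - N enumerates the window [-N, N]. *)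
have cov := residue_cover_addr (- N%:Z) (residue_cover_Posz m0).
have := @residue_cover_sum_bound R m _ (\1_(Per m x)) 1 N.*2.+1 m0 cov
  (@indic_Per_eqmod R x m) (@indic_norm_le1 R _ _).
rewrite -/S mulr1 ler_norml => /andP[_]; rewrite lerBlDl => SN.
apply: le_trans (le_trans SN _); last by rewrite le_eqVlt; apply/orP; left; apply/eqP; ring.
apply: ler_sum => i _; rewrite !indicE ler_nat.
have [Ai|nAi] := pselect (A (i%:Z - N%:Z)); last by rewrite (memNset nAi).
by rewrite (mem_set (Am _ Ai)) leq_b1.
Unshelve. all: by end_near. Qed.

(** Each F (z n) is compared with F at the shift of x by the residue of phi n. The two are within e
    unless the window around phi n meets a position outside [Per m x]; a union bound over the 2L + 1
    window positions limits how often this happens. *)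
Lemma average_bound (R : realType) (x : word) (m L N : nat) (M e : R)
    (F : toeplitz_system x -> R) (phi : nat -> int) (z : nat -> toeplitz_system x) :
  (0 < m)%N -> 0 <= M -> (forall y, `|F y| <= M) ->
  (forall y y' : toeplitz_system x,
    agree_on L (set_val y) (set_val y') -> `|F y - F y'| <= e) -> 0 <= e ->
  residue_cover m phi -> (forall n, aligned x m (phi n) (set_val (z n))) ->
  `|\sum_(n < N) F (z n) - N%:R / m%:R * \sum_(k < m) F (system_shift k%:Z point)| <=
  N%:R * (e + 2 * M * L.*2.+1%:R * (1 - (\sum_(k < m) \1_(Per m x) k%:Z) / m%:R)) +
  2 * m%:R * M * (1 + 2 * L.*2.+1%:R).
Proof.
move=> m0 M0 FM FL e0 phi_cov xz; have mR : 0 < m%:R :> R by rewrite ltr0n.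
set g := (\sum_(k < m) \1_(Per m x) k%:Z) / m%:R.
have /choice[rho rhoP] c : exists k : nat, (k < m)%N /\ (m%:Z %| k%:Z - c)%Z.
  by have [k ? ?] := dvdz_residue c m0; exists k.
pose h c := F (system_shift (rho c)%:Z point).
pose w c i : R := 1 - \1_(Per m x) (c + (i%:Z - L%:Z)).
have w01 c i : 0 <= w c i <= 1.
  by rewrite /w indicE; case: (_ \in _); rewrite ?subrr ?subr0 lexx ler01.
have h_per a b : (m%:Z %| a - b)%Z -> h a = h b.
  move=> ab; rewrite /h; have [am aE] := rhoP a; have [bm bE] := rhoP b.
  rewrite (eq_residue am bm) //.
  have -> : (rho a)%:Z - (rho b)%:Z = (rho a)%:Z - a + (a - b) - ((rho b)%:Z - b).
    by ring.
  by have := rpredB (rpredD aE ab) bE.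
(* If every w (phi n) i vanishes, z n agrees on [-L, L] with a shift of x by a
   residue; otherwise the sum is at least 1 and the trivial bound 2 M suffices. *)
have close n : `|F (z n) - h (phi n)| <= e + 2 * M * \sum_(i < L.*2.+1) w (phi n) i.
  have [xphi|] := pselect (forall i : 'I_L.*2.+1, Per m x (phi n + (i%:Z - L%:Z))).
    apply: ler_wpDr.
      by rewrite !mulr_ge0 ?sumr_ge0 // => i _; case/andP: (w01 (phi n) i).
    apply: FL => i iL; have iL' : (absz (i + L%:Z)%R < L.*2.+1)%N by lia.
    have := xphi (Ordinal iL'); rewrite /=.
    have -> : (absz (i + L%:Z))%:Z - L%:Z = i by lia.
    rewrite addrC => xi; rewrite (xz n i xi) /shiftw.
    have [_ rE] := rhoP (phi n).
    have [|_ //] := @Per_eqmod x m (i + phi n) (i + (rho (phi n))%:Z) _ xi.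
    by rewrite opprD addrACA subrr add0r.
  move=> /existsNP[i nxi]; apply: (@le_trans _ _ (2 * M)).
    by rewrite mulrDl mul1r; apply: le_trans (ler_normB _ _) (lerD (FM _) (FM _)).
  rewrite ler_wpDl // ler_peMr ?mulr_ge0 // (bigD1 i) //= ler_wpDr //.
    by rewrite sumr_ge0 // => j _; case/andP: (w01 (phi n) j).
  by rewrite /w indicE memNset // subr0.
(* For fixed i the positions phi n + i - L again cover all residues, so nonperiodic ones occur with
   frequency 1 - g, up to a count of 2m. *)
have w_sum (i : 'I_L.*2.+1) : \sum_(n < N) w (phi n) i <= N%:R * (1 - g) + 2 * m%:R.
  have cov := residue_cover_addr (i%:Z - L%:Z) phi_cov.
  have v_per (a b : int) : (m%:Z %| a - b)%Z ->
      1 - \1_(Per m x) a = 1 - \1_(Per m x) b :> R.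
    by move=> ab; rewrite (indic_Per_eqmod R x ab).
  have v1 (a : int) : `|1 - \1_(Per m x) a : R| <= 1.
    by rewrite indicE; case: (_ \in _); rewrite ?subrr ?subr0 ?normr0 ?normr1.
  have := residue_cover_sum_bound N m0 cov v_per v1.
  have -> : \sum_(k < m) (1 - \1_(Per m x) k%:Z) = m%:R * (1 - g) :> R.
    by rewrite sumrB sumr_const card_ord mulrBr mulr1 /g mulrC divfK ?gt_eqF.
  rewrite mulr1 mulrA divfK ?gt_eqF // => v_sum.
  by rewrite -lerBlDl; apply: le_trans (ler_norm _) v_sum.
have hM c : `|h c| <= M by exact: FM.
have hS := residue_cover_sum_bound N m0 phi_cov h_per hM.
have hE : \sum_(k < m) h k%:Z = \sum_(k < m) F (system_shift k%:Z point).
  apply: eq_bigr => k _; rewrite /h; have [rm rE] := rhoP k%:Z.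
  by rewrite (eq_residue rm (ltn_ord k) rE).
rewrite -hE; set H := _ * \sum_(k < m) _.
rewrite -(subrKA (\sum_(n < N) h (phi n))).
(* In the N-independent error, 2 m M comes from the sum of h, and the rest from 2m for each of the
   2L + 1 window positions, weighted by 2 M. *)
have -> : N%:R * (e + 2 * M * L.*2.+1%:R * (1 - g)) + 2 * m%:R * M * (1 + 2 * L.*2.+1%:R) =
  N%:R * e + 2 * M * (L.*2.+1%:R * (N%:R * (1 - g) + 2 * m%:R)) + 2 * m%:R * M by ring.
apply: le_trans (ler_normD _ _) (lerD _ hS).
rewrite -sumrB; apply: le_trans (ler_norm_sum _ _ _) _.
apply: le_trans (ler_sum _ (fun (n : 'I_N) _ => close n)) _.
rewrite big_split /= sumr_const card_ord -[e *+ N]mulr_natl lerD2l -mulr_sumr ler_wpM2l ?mulr_ge0 //.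
rewrite exchange_big /=; apply: le_trans (ler_sum _ (fun i _ => w_sum i)) _.
by rewrite sumr_const card_ord -[X in X <= _]mulr_natl.
Qed.

Lemma Per_dvdn (x : word) (m n : nat) : (m %| n)%N -> Per m x `<=` Per n x.
Proof.
move=> /dvdnP[k ->] a xa j; rewrite (xa (j * k%:Z)).
by rewrite PoszM mulrA.
Qed.

(** L comes from continuity, then t from regularity, and m from [n_ t]. The constant c does not
    depend on phi or z, so all orbits are compared with the same value. *)
Lemma uniform_average (R : realType) (x : word) (F : toeplitz_system x -> R)
    (e : R) : regular_system R x -> continuous F -> 0 < e ->
  exists m c N0, essential_period x m /\
    forall (N : nat) (phi : nat -> int) (z : nat -> toeplitz_system x),
      (N0 <= N)%N -> residue_cover m phi ->
      (forall n, aligned x m (phi n) (set_val (z n))) ->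
      `|(\sum_(n < N) F (z n)) / N%:R - c| <= e.
Proof.
move=> [n_ [n_gt0 n_dvd _ [d dP d1]]] cF e0.
have e3 : 0 < e / 3 by rewrite divr_gt0.
have [M M0 FM] := continuous_bounded cF.
have [L FL] := continuous_agree cF e3.
have C0 : 0 <= 2 * M * L.*2.+1%:R by rewrite !mulr_ge0.
have [t dt] : exists t, 2 * M * L.*2.+1%:R * (1 - d t) <= e / 3.
  (* The added 1 keeps the denominator positive even if M = 0. *)
  have C1 : 0 < e / 3 / (2 * M * L.*2.+1%:R + 1) by rewrite divr_gt0 // ltr_wpDl.
  have /cvgr_dist_le/(_ _ C1) dC := d1.
  near \oo => t; exists t.
  have : `|1 - d t| <= e / 3 / (2 * M * L.*2.+1%:R + 1) by near: t.
  move=> /(le_trans (ler_norm _)); rewrite ler_pdivlMr ?ltr_wpDl // => dtC.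
  have [dt1|/ltW dt1] := leP 0 (1 - d t); first by nra.
  by rewrite (le_trans _ (ltW e3)) // mulr_ge0_le0.
have [m m_ess nm] := essential_periodW x (n_gt0 t); have [m0 _] := m_ess.
set g := (\sum_(k < m) \1_(Per m x) k%:Z) / m%:R : R.
(* As [n_ s] divides [n_ t] for s <= t, the whole union lies in [Per (n_ t) x], hence in
   [Per m x]. *)
have dg : d t <= g.
  apply: density_Per_le (dP t) => // a [s /= st xa]; apply: nm.
  apply: Per_dvdn xa; elim: t st {dt} => [|t IH].
    by rewrite ltnS leqn0 => /eqP ->.
  rewrite ltnS leq_eqVlt => /predU1P[->//|/IH /dvdn_trans]; apply; exact: n_dvd.
pose B : R := 2 * m%:R * M * (1 + 2 * L.*2.+1%:R).
(* Beyond this N0 the error B, independent of N, is at most N e / 3; the successor keeps N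
   positive. *)
exists m, ((\sum_(k < m) F (system_shift k%:Z point)) / m%:R),
  (Num.bound (B / (e / 3))).+1.
split=> // N phi z N0 phi_cov xz.
have NR : 0 < N%:R :> R by rewrite ltr0n (leq_trans _ N0).
have BN : B <= N%:R * (e / 3).
  rewrite -ler_pdivrMr //; apply/ltW/(lt_le_trans (archi_boundP _)).
    by rewrite divr_ge0 ?(ltW e3) // !mulr_ge0 // addr_ge0 // mulr_ge0.
  by rewrite ler_nat (leq_trans _ N0).
have := average_bound N m0 M0 FM FL (ltW e3) phi_cov xz.
rewrite -/g -/B => avg.
rewrite -(ler_pM2l NR) -[X in X * _](ger0_norm (ltW NR)) -normrM mulrBr.
rewrite [N%:R * (_ / _)]mulrC divfK ?gt_eqF // [N%:R * (_ / m%:R)]mulrCA -[in X in _ - X]mulrC.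
apply: le_trans avg _.
have gt : 2 * M * L.*2.+1%:R * (1 - g) <= e / 3.
  by apply: le_trans dt; rewrite ler_wpM2l // lerD2l lerN2.
apply: le_trans (lerD (ler_wpM2l (ltW NR) (lerD (lexx _) gt)) BN) _.
by rewrite -mulrDr ler_wpM2l ?(ltW NR) //; lra.
Unshelve. all: by end_near. Qed.

(** * Integrals against an invariant measure *)

Lemma system_shiftD (x : word) (m n : int) (y : toeplitz_system x) :
  system_shift (m + n) y = system_shift m (system_shift n y).
Proof. by apply/val_inj; exact: shiftwD. Qed.

Lemma system_shift0 (x : word) (y : toeplitz_system x) : system_shift 0 y = y.
Proof. by apply/val_inj; exact: shiftw0. Qed.

Lemma system_shift_continuous (x : word) (n : int) :
  continuous (@system_shift x n).
Proof.
move=> y A [_ [[V oV <-] Vy VA]].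
have cs : continuous (fun z : toeplitz_system x => shiftw n (set_val z)).
  by move=> z; apply: continuous_comp; [exact: initial_continuous|exact: shiftw_continuous].
have := cs y V (open_nbhs_nbhs (conj oV Vy)).
by apply: (@filterS _ (nbhs y)) => z; exact: (VA (system_shift n z)).
Qed.

Lemma continuous_borel_measurable (T U : ptopologicalType) (f : T -> U) :
  continuous f -> measurable_fun [set: borel T] (f : borel T -> borel U).
Proof.
move=> /continuousP cf; apply: (@measurability _ _ (borel T) (borel U)
  setT f (@open U)) => // _ [A oA <-].
by rewrite setTI; apply: sub_sigma_algebra; exact: cf.
Qed.

Lemma continuous_real_measurable (R : realType) (T : ptopologicalType) (f : T -> R) :
  continuous f -> measurable_fun [set: borel T] (f : borel T -> R).
Proof.
move=> /continuousP cf; apply: (measurability _ (RGenOInfty.measurableE R)).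
move=> _ [_ [r ->] <-]; rewrite setTI; apply: sub_sigma_algebra.
by apply: cf; exact: interval_open.
Qed.

Lemma continuous_integrable (R : realType) (x : word)
    (mu : probability (borel (toeplitz_system x)) R)
    (F : toeplitz_system x -> R) : continuous F ->
  mu.-integrable setT (EFin \o (F : borel (toeplitz_system x) -> R)).
Proof.
move=> cF; apply: measurable_bounded_integrable => //.
- by rewrite (le_lt_trans (probability_le1 _ _)) ?ltry.
- exact: continuous_real_measurable.
- have [M _ FM] := continuous_bounded cF.
  by exists M; split=> [|r Mr y _]; [rewrite num_real|exact: le_trans (FM y) (ltW Mr)].
Qed.

(** Invariance says that the pushforward of [mu] under one shift agrees with [mu] on Borel sets.
    Change of variables turns this into equality of integrals, and induction reaches the powers. *)
Lemma Rintegral_shift (R : realType) (x : word)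
    (mu : probability (borel (toeplitz_system x)) R)
    (mu_invariant : shift_invariant mu)
    (F : toeplitz_system x -> R) (n : nat) : continuous F ->
  \int[mu]_y F (system_shift n%:Z y) = \int[mu]_y F y.
Proof.
move=> cF; elim: n => [|n IH].
  by apply: eq_Rintegral => y _; rewrite system_shift0.
rewrite -{}IH; pose Fn y := F (system_shift n%:Z y).
have cFn : continuous Fn.
  by move=> y; apply: continuous_comp; [exact: system_shift_continuous|exact: cF].
have m1 := continuous_borel_measurable (@system_shift_continuous x 1).
transitivity (\int[mu]_y Fn (system_shift 1 y)).
  by apply: eq_Rintegral => y _; rewrite /Fn -system_shiftD -addn1 PoszD.
have mF : measurable_fun setT (EFin \o (Fn : borel (toeplitz_system x) -> R)).
  by apply/measurable_EFinP; exact: (continuous_real_measurable cFn).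
have iF : mu.-integrable setT (EFin \o (Fn \o @system_shift x 1)).
  apply: continuous_integrable => y; apply: continuous_comp; last exact: cFn.
  exact: system_shift_continuous.
rewrite /Rintegral; congr fine.
rewrite -[LHS](integral_pushforward m1 mF iF measurableT).
by apply: eq_measure_integral => A mA _; exact: mu_invariant.
Qed.

Lemma Rintegral_orbit_sum (R : realType) (x : word)
    (mu : probability (borel (toeplitz_system x)) R)
    (mu_invariant : shift_invariant mu)
    (F : toeplitz_system x -> R) (N : nat) : continuous F ->
  \int[mu]_y (\sum_(n < N) F (system_shift n%:Z y)) = N%:R * \int[mu]_y F y.
Proof.
move=> cF; have cFn n : continuous (fun y => F (system_shift n%:Z y)).
  by move=> y; apply: continuous_comp; [exact: system_shift_continuous|exact: cF].
elim: N => [|N IH].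
  under eq_Rintegral do rewrite big_ord0.
  by rewrite Rintegral_cst // !mul0r.
under eq_Rintegral do rewrite big_ord_recr /=.
rewrite RintegralD //; first by rewrite IH Rintegral_shift // -natr1 mulrDl mul1r.
  apply: continuous_integrable.
  by apply: continuous_big => [|i _]; [exact: add_continuous|exact: cFn].
by apply: continuous_integrable; exact: cFn.
Qed.

(** As [mu] has mass 1, constants integrate to themselves, and the bounds c - e and c + e pass to
    the integral. *)
Lemma Rintegral_near (R : realType) (x : word)
    (mu : probability (borel (toeplitz_system x)) R)
    (f : toeplitz_system x -> R) (c e : R) : continuous f ->
  (forall y, `|f y - c| <= e) -> `|\int[mu]_y f y - c| <= e.
Proof.
move=> cf fc; have cst r : \int[mu]_(_ in setT) r = r.
  rewrite Rintegral_cst //; rewrite -[RHS]mulr1.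
  by congr (_ * _); rewrite -[RHS]/(fine 1%E); congr fine; exact: probability_setT.
have if_ := continuous_integrable mu cf.
have ic r : mu.-integrable setT (EFin \o (fun=> r : R)).
  by apply: continuous_integrable; exact: cst_continuous.
have le_f y : c - e <= f y <= c + e by rewrite -ler_distl; exact: fc.
rewrite ler_distl -[X in X <= _](cst (c - e)) -[X in _ && (_ <= X)](cst (c + e)).
by apply/andP; split; apply: le_Rintegral => // y _; case/andP: (le_f y).
Qed.

Lemma continuous_orbit_sum (R : realType) (x : word) (F : toeplitz_system x -> R)
    (N : nat) :
  continuous F -> continuous (fun y => \sum_(n < N) F (system_shift n%:Z y)).
Proof.
move=> cF; apply: continuous_big => [|i _ y]; first exact: add_continuous.
by apply: continuous_comp; [exact: system_shift_continuous|exact: cF].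
Qed.

(** Lets F be replaced under the integral by its orbit averages, which are uniformly close to a
    constant. *)
Lemma Rintegral_average (R : realType) (x : word)
    (mu : probability (borel (toeplitz_system x)) R) (mu_invariant : shift_invariant mu)
    (F : toeplitz_system x -> R) (N : nat) : continuous F -> (0 < N)%N ->
  \int[mu]_y ((\sum_(n < N) F (system_shift n%:Z y)) / N%:R) = \int[mu]_y F y.
Proof.
move=> cF N0.
rewrite RintegralZr //; last by apply: continuous_integrable; exact: continuous_orbit_sum.
by rewrite Rintegral_orbit_sum // mulrC mulKf // pnatr_eq0 -lt0n.
Qed.

(** * Equidistribution for real-valued functions *)

Lemma real_equidistributed (R : realType) (x : word) (P : {poly int})
    (y0 y : toeplitz_system x) (mu : probability (borel (toeplitz_system x)) R)
    (F : toeplitz_system x -> R) :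
  regular_system R x -> shift_invariant mu ->
  dense [set system_shift P.[n%:Z] y0 | n in [set n : nat | (0 < n)%N]] ->
  continuous F ->
  (\sum_(1 <= n < N.+1) F (system_shift P.[n%:Z] y)) / N%:R @[N --> \oo] -->
    \int[mu]_z F z.
Proof.
move=> x_regular mu_invariant P_dense cF; apply/cvgrPdist_le => e e0.
have e2 : 0 < e / 2 by rewrite divr_gt0.
have [m [c [N0 [m_ess avg]]]] := uniform_average x_regular cF e2.
have [m0 _] := m_ess.
(* Density of the orbit of y0 becomes surjectivity of P modulo m, which no longer refers to a point
   and so serves every y. *)
have P_cov : residue_cover m (fun n => P.[n%:Z]).
  by split=> [k l|]; [exact: horner_eqmod|exact: dense_orbit_residues P_dense m_ess].
have intF : `|\int[mu]_z F z - c| <= e / 2.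
  (* The length N0 + 1 is positive and at least N0, so the averages along the full orbit of every z
     are already within e/2 of c. *)
  rewrite -(Rintegral_average mu_invariant cF (ltn0Sn N0)).
  apply: Rintegral_near => [|z].
    have cS := continuous_orbit_sum (N := N0.+1) cF.
    by move=> z; apply: cvgMr_tmp; [exact: nbhs_filter|exact: cS].
  have [r xr] := orbit_closure_aligned m0 (set_valP z).
  apply: (avg _ (fun n => n%:Z + r) (fun n => system_shift n%:Z z)) => // [|n].
    exact: residue_cover_addr (residue_cover_Posz m0).
  exact: aligned_shiftw.
have [r xr] := orbit_closure_aligned m0 (set_valP y).
(* The sum over 1 <= n <= N is reindexed from 0, hence the values P(n + 1) below. *)
near=> N; rewrite big_add1 big_mkord /= (splitr e).
rewrite -(subrKA c) (le_trans (ler_normD _ _)) // lerD // distrC.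
apply: (avg _ (fun n => P.[n.+1%:Z] + r)
  (fun n => system_shift P.[n.+1%:Z] y)) => [||n].
- by near: N; exact: nbhs_infty_ge.
- exact: residue_cover_addr (residue_coverS m0 P_cov).
- exact: aligned_shiftw.
Unshelve. all: by end_near. Qed.

(** * Passage to complex-valued functions *)

Lemma ReB (R : realType) (z w : R[i]) : complex.Re (z - w) = complex.Re z - complex.Re w.
Proof. by case: z => a b; case: w. Qed.

Lemma ImB (R : realType) (z w : R[i]) : complex.Im (z - w) = complex.Im z - complex.Im w.
Proof. by case: z => a b; case: w. Qed.

Lemma normc_ge_Im (R : realType) (z : R[i]) : (`|complex.Im z|)%:C%C <= `|z|.
Proof. by rewrite normc_def lecR -sqrtr_sqr ler_wsqrtr // lerDr sqr_ge0. Qed.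

Lemma normc_le_ReIm (R : realType) (z : R[i]) :
  `|z| <= (`|complex.Re z| + `|complex.Im z|)%:C%C.
Proof.
rewrite normc_def lecR -[leRHS]ger0_norm ?addr_ge0 // -sqrtr_sqr ler_wsqrtr //.
by rewrite sqrrD !real_normK ?num_real // lerD2r lerDl mulrn_wge0 // mulr_ge0.
Qed.

(** The modulus dominates |Re| and |Im| and is dominated by their sum. *)
Lemma cvg_complexP (R : realType) (T : Type) (G : set_system T)
    (f : T -> R[i]) (l : R[i]) :
  Filter G ->
  ((f : T -> R[i]^o) @ G --> (l : R[i]^o)) <->
  ((fun t => complex.Re (f t)) @ G --> complex.Re l) /\
  ((fun t => complex.Im (f t)) @ G --> complex.Im l).
Proof.
move=> FG; split=> [fl|[fRe fIm]].
  split; apply/cvgrPdist_lt => e e0; have e0' : 0 < e%:C%C :> R[i] by rewrite ltcR.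
    have /cvgrPdist_lt/(_ _ e0') := fl; apply: filterS => t fe.
    have := le_lt_trans (normc_ge_Re (l - f t)) fe.
    by rewrite ltcR ReB.
  have /cvgrPdist_lt/(_ _ e0') := fl; apply: filterS => t fe.
  have := le_lt_trans (normc_ge_Im (l - f t)) fe.
  by rewrite ltcR ImB.
(* In the order of [R[i]], 0 < e forces e to be real, so e can be halved through its real part. *)
apply/cvgrPdist_lt => e; rewrite ltcE => /andP[/eqP e_im /= e_re].
have eE : e = (complex.Re e)%:C%C by case: e e_im {e_re} => a b /= ->.
have e2 : 0 < complex.Re e / 2 by rewrite divr_gt0.
have /cvgrPdist_lt/(_ _ e2) Re_near := fRe.
have /cvgrPdist_lt/(_ _ e2) Im_near := fIm.
near=> t; rewrite eE; apply: le_lt_trans (normc_le_ReIm _) _.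
rewrite ltcR (splitr (complex.Re e)) ReB ImB ltrD //.
  by near: t.
by near: t.
Unshelve. all: by end_near. Qed.

Lemma Re_average (R : realType) (u : nat -> R[i]) (N : nat) :
  complex.Re ((\sum_(1 <= n < N.+1) u n) / N%:R) =
  (\sum_(1 <= n < N.+1) complex.Re (u n)) / N%:R.
Proof.
have -> : (N%:R)^-1 = ((N%:R)^-1)%:C%C :> R[i] by rewrite fmorphV rmorph_nat.
rewrite -(@big_morph _ _ (@complex.Re R) 0 +%R 0 +%R) //; last by case=> a b [].
by case: (\sum_(1 <= n < N.+1) u n) => a b /=; rewrite mulr0 subr0.
Qed.

Lemma Im_average (R : realType) (u : nat -> R[i]) (N : nat) :
  complex.Im ((\sum_(1 <= n < N.+1) u n) / N%:R) =
  (\sum_(1 <= n < N.+1) complex.Im (u n)) / N%:R.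
Proof.
have -> : (N%:R)^-1 = ((N%:R)^-1)%:C%C :> R[i] by rewrite fmorphV rmorph_nat.
rewrite -(@big_morph _ _ (@complex.Im R) 0 +%R 0 +%R) //; last by case=> a b [].
by case: (\sum_(1 <= n < N.+1) u n) => a b /=; rewrite mulr0 add0r.
Qed.

Theorem theorem1p2 (R : realType) (x : word)
    (x_toeplitz : toeplitz_word x) (x_regular : regular_system R x)
    (P : {poly int})
    (P_dense : exists y : toeplitz_system x,
      dense [set system_shift P.[n%:Z] y | n in [set n : nat | (0 < n)%N]])
    (mu : probability (borel (toeplitz_system x)) R)
    (mu_invariant : shift_invariant mu)
    (y : toeplitz_system x) :
  equidistributed mu (fun n : nat => system_shift P.[n%:Z] y).
Proof.
(* [Cintegral] has the integrals of the real and imaginary parts as its components, so each part is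
   treated separately. *)
case: P_dense => y0 P_dense F cF; apply/cvg_complexP.
have cRe : continuous (fun z => complex.Re (F z)).
  by move=> z; have /cvg_complexP[] := cF z.
have cIm : continuous (fun z => complex.Im (F z)).
  by move=> z; have /cvg_complexP[] := cF z.
split.
  rewrite (_ : (fun N => _) = (fun N => (\sum_(1 <= n < N.+1)
    complex.Re (F (system_shift P.[n%:Z] y))) / N%:R)).
    exact: real_equidistributed x_regular mu_invariant P_dense cRe.
  by apply/funext => N; exact: Re_average.
rewrite (_ : (fun N => _) = (fun N => (\sum_(1 <= n < N.+1)
  complex.Im (F (system_shift P.[n%:Z] y))) / N%:R)).
  exact: real_equidistributed x_regular mu_invariant P_dense cIm.
by apply/funext => N; exact: Im_average.
Qed.
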